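(* For every positive integer $k$, every bipartite graph admits a strongly $k$-uniform integer additive set-indexer.
   Context: All graphs are simple, finite and have no isolated vertices. $\mathbb{N}_0$ is the set of non-negative integers; set-labels are non-empty finite subsets of $\mathbb{N}_0$. For sets $A,B$, $A+B=\{a+b: a\in A, b\in B\}$. An integer additive set-indexer (IASI) of a graph $G$ is an injective function $f:V(G)\to 2^{\mathbb{N}_0}$ such that the induced function $f^+:E(G)\to 2^{\mathbb{N}_0}$, $f^+(uv)=f(u)+f(v)$, is also injective. An IASI $f$ is strong if $|f^+(uv)|=|f(u)|\,|f(v)|$ for every edge $uv$. A strong IASI $f$ is strongly $k$-uniform if $|f^+(e)|=k$ for every edge $e$. *)

(* Defs.v *)
From mathcomp Require Import all_boot finmap.

Set Implicit Arguments.
Unset Strict Implicit.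
Unset Printing Implicit Defensive.

Record sgraph := SGraph {
  vertex :> finType;
  adj : rel vertex;
  adj_sym : symmetric adj;
  adj_irrefl : irreflexive adj;
  adj_no_isolated : forall u : vertex, exists v : vertex, adj u v
}.

Definition bipartite (G : sgraph) : Prop :=
  exists X : {set G}, forall u v : G, adj u v -> (u \in X) != (v \in X).

Definition sumset (A B : {fset nat}) : {fset nat} :=
  [fset (a + b)%N | a in A, b in B]%fset.

(* Induced label of the edge uv; it depends only on the unordered pair
   {u, v} because sumset is commutative. *)
Definition edge_label (G : sgraph) (f : G -> {fset nat}) (u v : G) :
  {fset nat} := sumset (f u) (f v).

(* Edges are compared as unordered pairs [set u; v]. *)
Definition IASI (G : sgraph) (f : G -> {fset nat}) : Prop :=
  [/\ forall u : G, f u <> fset0,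
      injective f
    & forall u v u' v' : G, adj u v -> adj u' v' ->
        edge_label f u v = edge_label f u' v' ->
        [set u; v] = [set u'; v'] ].

Definition strong_IASI (G : sgraph) (f : G -> {fset nat}) : Prop :=
  IASI f /\
  forall u v : G, adj u v -> #|` edge_label f u v| = #|` f u| * #|` f v|.

Definition strongly_uniform_IASI (G : sgraph) (k : nat) (f : G -> {fset nat}) :
  Prop :=
  strong_IASI f /\ forall u v : G, adj u v -> #|` edge_label f u v| = k.

(* Main.v *)
Require Import Defs.
From mathcomp Require Import all_boot finmap zify.

(** Give the vertices of one part singletons and those of the other part
    intervals of length [k], with distinct powers of two as minima. Every edge
    label is then an interval of length [k], whose minimum is the sum of two
    distinct powers of two and hence determines the edge. *)

Definition interval (m n : nat) : {fset nat} := [fset x in iota m n]%fset.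

Lemma in_interval m n x : (x \in interval m n) = (m <= x < m + n).
Proof. by rewrite !inE mem_iota. Qed.

Lemma card_interval m n : #|` interval m n| = n.
Proof. by rewrite card_fseq undup_id ?iota_uniq // size_iota. Qed.

(** Each minimum lies in its own interval, hence in the other one, which gives both inequalities.
    The lengths may differ because two vertices can carry labels of different lengths. *)
Lemma interval_inj_min a m b n :
  0 < m -> 0 < n -> interval a m = interval b n -> a = b.
Proof.
move=> m0 n0 /fsetP e.
have := e a; have := e b; rewrite !in_interval; lia.
Qed.

Lemma sumset_interval a m b n : 0 < m -> 0 < n ->
  sumset (interval a m) (interval b n) = interval (a + b) (m + n).-1.
Proof.
move=> m0 n0; apply/fsetP => x; rewrite in_interval; apply/imfset2P/idP.
  move=> [y /=]; rewrite in_interval => hy [z].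
  by rewrite in_interval => hz ->; lia.
(* The offset of [x] from [a + b] is split greedily: the first summand takes as much as fits, at
   most [m.-1], and the second takes the rest. *)
move=> hx; exists (a + minn (x - (a + b)) m.-1) => /=.
  by rewrite in_interval; lia.
exists (x - (a + minn (x - (a + b)) m.-1)); last by lia.
by rewrite in_interval; lia.
Qed.

(** The larger exponent decides: for [i < j < l], [2 ^ i + 2 ^ j < 2 ^ j.+1 <= 2 ^ l]. So the larger
    exponents agree, and cancelling them leaves the smaller ones. *)
Lemma add_exp2_inj_lt a b c d : a < b -> c < d ->
  2 ^ a + 2 ^ b = 2 ^ c + 2 ^ d -> a = c /\ b = d.
Proof.
have top i j k l : i < j -> j < l -> 2 ^ i + 2 ^ j < 2 ^ k + 2 ^ l.
  move=> ij jl.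
  have h1 : 2 ^ i < 2 ^ j by rewrite ltn_exp2l.
  have h2 : 2 ^ j.+1 <= 2 ^ l by rewrite leq_exp2l.
  by rewrite expnS in h2; lia.
move=> ab cd e; case: (ltngtP b d) => bd.
- by have := top a b c d ab bd; rewrite e ltnn.
- by have := top c d a b cd bd; rewrite e ltnn.
split=> //; move: e; rewrite bd => /addIn /eqP.
by rewrite eqn_exp2l // => /eqP.
Qed.

Lemma add_exp2_inj a b c d : a != b -> c != d ->
  2 ^ a + 2 ^ b = 2 ^ c + 2 ^ d -> a = c /\ b = d \/ a = d /\ b = c.
Proof.
case: (ltngtP a b) => // ab _; case: (ltngtP c d) => // cd _ e.
- by left; apply: add_exp2_inj_lt.
- by right; apply: add_exp2_inj_lt; rewrite // e addnC.
- by right; apply/and_comm; apply: add_exp2_inj_lt; rewrite // addnC e.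
- left; apply/and_comm; apply: add_exp2_inj_lt; rewrite // addnC e.
  by rewrite addnC.
Qed.

Theorem theorem4 (k : nat) (G : sgraph) (hk : 0 < k) (hG : bipartite G) :
  exists f : G -> {fset nat}, strongly_uniform_IASI k f.
Proof.
case: hG => X bipX.
pose r (u : G) : nat := enum_rank u.
have r_inj : injective r by move=> u v /val_inj /enum_rank_inj.
pose s (u : G) := if u \in X then 1 else k.
have s_gt0 u : 0 < s u by rewrite /s; case: ifP.
pose f (u : G) := interval (2 ^ r u) (s u).
have edgeE u v : adj u v -> edge_label f u v = interval (2 ^ r u + 2 ^ r v) k.
  move=> /bipX uv; rewrite /edge_label sumset_interval //; congr interval.
  (* Exactly one endpoint lies in [X], so the lengths are 1 and [k] in some order, and
     [(1 + k).-1 = k]. *)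
  by move: uv; rewrite /s; case: (u \in X); case: (v \in X) => //= _; lia.
have r_neq u v : adj u v -> r u != r v.
  move=> uv; apply: contraTneq uv => /r_inj ->.
  by rewrite adj_irrefl.
exists f; split; last by move=> u v /edgeE ->; rewrite card_interval.
split; last first.
  move=> u v uv; rewrite (edgeE _ _ uv) !card_interval.
  move: (bipX _ _ uv); rewrite /s.
  by case: (u \in X); case: (v \in X) => //= _; lia.
split=> [u fu0|u v|u v u' v' uv uv'].
- have := card_interval (2 ^ r u) (s u); have := s_gt0 u.
  by rewrite -/(f u) fu0 cardfs0 => h e; rewrite -e in h.
- move=> /(interval_inj_min _ _ _ _ (s_gt0 u) (s_gt0 v)) /eqP.
  by rewrite eqn_exp2l // => /eqP /r_inj.
rewrite !edgeE // => /(interval_inj_min _ _ _ _ hk hk).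
(* The two cases are the two ways of matching the endpoints; both give the same unordered pair. *)
case/(add_exp2_inj _ _ _ _ (r_neq _ _ uv) (r_neq _ _ uv')).
  by move=> [/r_inj -> /r_inj ->].
by move=> [/r_inj -> /r_inj ->]; rewrite setUC.
Qed.
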